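(* Let $RB$ be the variety of rectangular bands, i.e. the variety of all bands satisfying the identity $y\approx yxy$. Then $\dim(RB)=2$.
   Context: A band is an idempotent semigroup, viewed as an algebra of type $(2)$ (one binary operation, written as juxtaposition). A hypersubstitution of type $(2)$ is a choice $\sigma$ of a binary term $\sigma(xy)$ in the variables $x,y$. For an algebra $\mathbf{A}=(A,\cdot)$ of type $(2)$ the derived algebra $\mathbf{A}_{\sigma}$ is the set $A$ with the binary term operation induced by $\sigma(xy)$ on $\mathbf{A}$. For a variety $V$ of type $(2)$, the derived variety $V_{\sigma}$ is the variety (of type $(2)$) generated by $\{\mathbf{A}_{\sigma}:\mathbf{A}\in V\}$; it is proper if $V_{\sigma}\neq V$. The dimension $\dim(V)$ is the cardinality of the set of all proper derived varieties $V_{\sigma}$ of $V$ that are included in $V$, where $\sigma$ ranges over all hypersubstitutions of type $(2)$. *)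

(* Defs.v *)
From mathcomp Require Import all_boot.
From mathcomp Require Import boolp classical_sets functions cardinality.

Set Implicit Arguments.
Unset Strict Implicit.
Unset Printing Implicit Defensive.

Local Open Scope classical_set_scope.

(* Algebras of type (2), with a nonempty carrier as usual in universal algebra.
   MathComp's magmaType is not used: its carrier universe is too large for
   classes of magmas to be formed with [set]. *)
Record algebra := Algebra {
  carrier :> Type;
  op : carrier -> carrier -> carrier;
  carrier_inhabited : inhabited carrier
}.

Declare Scope algebra_scope.
Delimit Scope algebra_scope with A.
Notation "x * y" := (op x y) : algebra_scope.
Local Open Scope algebra_scope.

(* Terms of type (2) in the two variables x and y. *)
Inductive binterm := VarX | VarY | Mul of binterm & binterm.

Fixpoint eval (A : algebra) (t : binterm) (x y : A) : A :=
  match t with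
  | VarX => x
  | VarY => y
  | Mul t1 t2 => eval t1 x y * eval t2 x y
  end.

(* A hypersubstitution s is given by the binary term s(xy). *)
Definition hypersubst := binterm.

Definition derived (s : hypersubst) (A : algebra) : algebra :=
  @Algebra A (@eval A s) (carrier_inhabited A).

Lemma prod_inhabited (I : Type) (F : I -> algebra) :
  inhabited (forall i, F i).
Proof.
have e (i : I) : exists _ : F i, True.
  by case: (carrier_inhabited (F i)) => a; exists a.
exact: inhabits (fun i => projT1 (cid (e i))).
Qed.

Definition prod_algebra (I : Type) (F : I -> algebra) : algebra :=
  @Algebra (forall i, F i) (fun f g i => f i * g i) (prod_inhabited F).

Definition hom (A B : algebra) (f : A -> B) : Prop :=
  forall x y : A, f (x * y) = f x * f y.

(* Closure under homomorphic images, subalgebras and direct products;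
   a subalgebra is given, up to isomorphism, by an injective homomorphism. *)
Definition variety (V : set algebra) : Prop :=
  [/\ forall (A B : algebra) (f : A -> B),
        V A -> hom f -> (forall b, exists a, f a = b) -> V B,
      forall (A B : algebra) (f : B -> A),
        V A -> hom f -> injective f -> V B
    & forall (I : Type) (F : I -> algebra),
        (forall i, V (F i)) -> V (prod_algebra F)].

Definition generated_variety (K : set algebra) : set algebra :=
  smallest variety K.

Definition derived_variety (s : hypersubst) (V : set algebra) : set algebra :=
  generated_variety [set derived s A | A in V].

Definition proper_derived_subvarieties (V : set algebra) : set (set algebra) :=
  [set W | (exists s : hypersubst, W = derived_variety s V)
           /\ W <> V /\ W `<=` V].

(* dim V = n, for a finite cardinal n. *)
Definition has_dim (V : set algebra) (n : nat) : Prop :=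
  (proper_derived_subvarieties V #= `I_n)%card.

Definition band : set algebra :=
  [set A : algebra | (forall x y z : A, x * (y * z) = (x * y) * z)
           /\ (forall x : A, x * x = x)].

Definition RB : set algebra :=
  [set A : algebra | band A /\ forall x y : A, y = y * x * y].

(* Main.v *)
From mathcomp Require Import all_boot.
From mathcomp Require Import boolp classical_sets functions cardinality.
Require Import Defs.

(** In a rectangular band [xyz = xz], so every binary term [s] equals the product
    of its first and its last variable.  Hence the derived operations are [x], [y],
    [xy] and [yx]; the first two yield the varieties of left and of right zero
    bands, while [xy] and [yx] both yield [RB] itself, which is self-dual. *)

Set Implicit Arguments.
Unset Strict Implicit.
Unset Printing Implicit Defensive.

Local Open Scope classical_set_scope.
Local Open Scope algebra_scope.

Definition left_zero : set algebra :=
  [set A : algebra | forall x y : A, x * y = x].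

Definition right_zero : set algebra :=
  [set A : algebra | forall x y : A, x * y = y].

Lemma variety_left_zero : variety left_zero.
Proof.
split=> [A B f VA hf sf x y | A B f VA hf injf x y | I F VF x y].
- by have [a <-] := sf x; have [b <-] := sf y; rewrite -hf VA.
- by apply: injf; rewrite hf VA.
- by apply: functional_extensionality_dep => i /=; rewrite VF.
Qed.

Lemma variety_right_zero : variety right_zero.
Proof.
split=> [A B f VA hf sf x y | A B f VA hf injf x y | I F VF x y].
- by have [a <-] := sf x; have [b <-] := sf y; rewrite -hf VA.
- by apply: injf; rewrite hf VA.
- by apply: functional_extensionality_dep => i /=; rewrite VF.
Qed.

Lemma variety_RB : variety RB.
Proof.
split=> [A B f [[mulA mulI] mulR] hf sf | A B f [[mulA mulI] mulR] hf injf
        | I F VF].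
- split; [split=> [x y z|x] | move=> x y]; have [a <-] := sf x.
  + by have [b <-] := sf y; have [c <-] := sf z; rewrite -!hf mulA.
  + by rewrite -hf mulI.
  + by have [b <-] := sf y; rewrite -!hf -mulR.
- split; [split=> [x y z|x] | move=> x y]; apply: injf; rewrite !hf.
  + exact: mulA.
  + exact: mulI.
  + exact: mulR.
- split; [split=> [x y z|x] | move=> x y];
    apply: functional_extensionality_dep => i /=; have [[mulA mulI] mulR] := VF i.
  + exact: mulA.
  + exact: mulI.
  + exact: mulR.
Qed.

(** Both sides equal [xyzxz]: on the left [z] is expanded to [zxz], on the right [x] to [x(yz)x]. *)
Lemma RB_mul3 (A : algebra) : RB A -> forall x y z : A, x * y * z = x * z.
Proof.
move=> [[mulA _] mulR] x y z.
by rewrite {1}(mulR x z) [in RHS](mulR (y * z) x) !mulA.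
Qed.

(** The variable is returned as a term, so that [Mul (first_var s) (last_var s)] is again a
    hypersubstitution. *)
Fixpoint first_var (t : binterm) : binterm :=
  if t is Mul t1 _ then first_var t1 else t.

Fixpoint last_var (t : binterm) : binterm :=
  if t is Mul _ t2 then last_var t2 else t.

(** Induction on [t]: variables are idempotent, and in a product of two such two-letter words
    [RB_mul3] deletes both inner letters. *)
Lemma eval_RB (A : algebra) (t : binterm) : RB A ->
  forall x y : A, eval t x y = eval (first_var t) x y * eval (last_var t) x y.
Proof.
move=> RBA x y; have [[mulA mulI] _] := RBA.
elim: t => [||t1 IH1 t2 IH2] /=; rewrite ?mulI // IH1 IH2.
by rewrite (RB_mul3 RBA) mulA (RB_mul3 RBA).
Qed.

(** Both records share carrier and inhabitation proof, so Leibniz equality reduces to extensionality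
    of the operations. *)
Lemma eq_derived (s t : hypersubst) (A : algebra) :
  (forall x y : A, eval s x y = eval t x y) -> derived s A = derived t A.
Proof.
move=> est; rewrite /derived; congr Algebra.
by apply/funext => x; apply/funext => y; exact: est.
Qed.

Lemma derived_op (s : hypersubst) (A : algebra) :
  (forall x y : A, eval s x y = x * y) -> derived s A = A.
Proof.
case: A => A m iA est; rewrite /derived; congr Algebra.
by apply/funext => x; apply/funext => y; exact: est.
Qed.

Lemma eq_derived_variety (s t : hypersubst) (V : set algebra) :
  (forall A : algebra, V A -> forall x y : A, eval s x y = eval t x y) ->
  derived_variety s V = derived_variety t V.
Proof.
move=> est; congr (smallest variety _); apply: eq_imagel => A VA.
exact/eq_derived/est.
Qed.

(** When the derived algebras already form a variety, generation adds nothing. This settles all four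
    reduced words. *)
Lemma derived_varietyE (s : hypersubst) (V W : set algebra) : variety W ->
  (forall A, V A -> W (derived s A)) ->
  (forall B, W B -> exists2 A, V A & derived s A = B) ->
  derived_variety s V = W.
Proof.
move=> varW sub sup; rewrite /derived_variety /generated_variety.
suff -> : [set derived s A | A in V] = W by exact: smallest_id.
by apply/seteqP; split=> [_ [A VA <-]|B /sup//]; exact: sub.
Qed.

Lemma left_zero_RB : left_zero `<=` RB.
Proof.
by move=> A mulE; split; [split=> [x y z|x] | move=> x y]; rewrite !mulE.
Qed.

Lemma right_zero_RB : right_zero `<=` RB.
Proof.
by move=> A mulE; split; [split=> [x y z|x] | move=> x y]; rewrite !mulE.
Qed.

Lemma derived_varietyX : derived_variety VarX RB = left_zero.
Proof.
apply: derived_varietyE => [|//|B LB]; first exact: variety_left_zero.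
(* A left zero band is its own derived algebra under the first projection. *)
by exists B; [exact: left_zero_RB | apply: derived_op => x y; rewrite LB].
Qed.

Lemma derived_varietyY : derived_variety VarY RB = right_zero.
Proof.
apply: derived_varietyE => [|//|B LB]; first exact: variety_right_zero.
by exists B; [exact: right_zero_RB | apply: derived_op => x y; rewrite LB].
Qed.

Lemma derived_varietyXY : derived_variety (Mul VarX VarY) RB = RB.
Proof.
apply: derived_varietyE => [|A RBA|B RBB]; first exact: variety_RB.
  by rewrite derived_op.
by exists B; rewrite ?derived_op.
Qed.

Lemma derived_varietyYX : derived_variety (Mul VarY VarX) RB = RB.
Proof.
have dualRB (A : algebra) : RB A -> RB (derived (Mul VarY VarX) A).
  move=> [[mulA mulI] mulR]; split; first split=> [x y z|x] /=.
  - by rewrite mulA.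
  - exact: mulI.
  - by move=> x y; rewrite [RHS]mulA; exact: mulR.
apply: derived_varietyE => [||B RBB]; [exact: variety_RB | exact: dualRB |].
(* Reversing the multiplication twice gives [B] back, so the opposite of [B] is the required
   preimage. *)
exists (derived (Mul VarY VarX) B); first exact: dualRB.
by case: B {RBB} => B m iB.
Qed.

Lemma derived_variety_RB (s : hypersubst) :
  [\/ derived_variety s RB = left_zero, derived_variety s RB = right_zero
    | derived_variety s RB = RB].
Proof.
have firstE t : first_var t = VarX \/ first_var t = VarY.
  by elim: t => [||t1 IH t2 _] /=; [left|right|].
have lastE t : last_var t = VarX \/ last_var t = VarY.
  by elim: t => [||t1 _ t2 IH] /=; [left|right|].
have -> : derived_variety s RB
        = derived_variety (Mul (first_var s) (last_var s)) RB.
  by apply: eq_derived_variety => A RBA x y; exact: eval_RB.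
(* The four words are [xx], [xy], [yx], [yy]; by idempotence the outer two act as projections. *)
case: (firstE s) => ->; case: (lastE s) => ->.
- apply: Or31; rewrite -derived_varietyX; apply: eq_derived_variety.
  by move=> A [[_ mulI] _] x y; exact: mulI.
- by apply: Or33; exact: derived_varietyXY.
- by apply: Or33; exact: derived_varietyYX.
- apply: Or32; rewrite -derived_varietyY; apply: eq_derived_variety.
  by move=> A [[_ mulI] _] x y; exact: mulI.
Qed.

(** Two elements suffice to tell the projections apart; on a singleton they coincide. *)
Definition bool_left_zero : algebra :=
  @Algebra bool (fun x _ => x) (inhabits true).

Definition bool_right_zero : algebra :=
  @Algebra bool (fun _ y => y) (inhabits true).

Lemma bool_left_zeroN : ~ right_zero bool_left_zero.
Proof. by move=> /(_ true false). Qed.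

Lemma bool_right_zeroN : ~ left_zero bool_right_zero.
Proof. by move=> /(_ true false). Qed.

Lemma left_zero_neq_right_zero : left_zero <> right_zero.
Proof.
by move=> E; apply: bool_left_zeroN; rewrite -E.
Qed.

(** The two-element right zero band is rectangular but not left zero. *)
Lemma left_zero_neq_RB : left_zero <> RB.
Proof.
move=> E; apply: bool_right_zeroN; rewrite E.
exact: right_zero_RB.
Qed.

Lemma right_zero_neq_RB : right_zero <> RB.
Proof.
move=> E; apply: bool_left_zeroN; rewrite E.
exact: left_zero_RB.
Qed.

Lemma proper_derived_subvarieties_RB :
  proper_derived_subvarieties RB = [set left_zero; right_zero].
Proof.
apply/seteqP; split=> W.
  move=> [[s ->] [neq _]].
  (* Properness rules out the third case, where the derived variety is [RB]. *)
  by case: (derived_variety_RB s) neq => -> // neq; [left|right].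
case=> ->.
- split; first by exists VarX; rewrite derived_varietyX.
  by split; [exact: left_zero_neq_RB | exact: left_zero_RB].
- split; first by exists VarY; rewrite derived_varietyY.
  by split; [exact: right_zero_neq_RB | exact: right_zero_RB].
Qed.

(** Since [b] differs from [a], removing [a] leaves the singleton of [b]. *)
Lemma card_set2 (T : Type) (a b : T) : a <> b -> ([set a; b] #= `I_2)%card.
Proof.
move=> neq; apply/eq_cardSP; exists a; first by left.
suff -> : [set a; b] `\ a = [set b] by exact: card_set1.
by apply/seteqP; split=> [x [[->|->]]|_ ->] //=; split; [right | move/esym].
Qed.

Theorem theorem4p3 : has_dim RB 2.
Proof.
rewrite /has_dim proper_derived_subvarieties_RB.
exact: card_set2 left_zero_neq_right_zero.
Qed.
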